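(* Let $$H(a_1, \ldots, a_n)=\sum_{j,k=1}^m c_{jk}\,h_j(a_1, \ldots,a_n)\,h_k(a_1, \ldots, a_n)$$ with real coefficients $c_{jk}$ and let $-\infty \le r < s \le \infty$. Put $$P(x,y)=\sum_{j,k=1}^m c_{jk}\, h_j(x,x, \ldots,x)\, h_k(y,y, \ldots, y),$$ where $x$ and $y$ are each repeated $n$ times. If $P(x,y) \ge 0$ for $(x,y) \in (r,s)^2 \setminus\{(0,0)\}$ and $H(a,a, \ldots, a)>0$ for $a \in (r,s) \setminus\{0\}$, then $H(a_1, \ldots, a_n) >0$ for all $(a_1, \ldots, a_n)\in (r,s)^n \setminus\{(0,\ldots,0)\}$.
   Context: For a nonnegative integer $j$, $h_j(a_1,\ldots,a_n)=\sum_{1\le i_1\le i_2\le\cdots\le i_j\le n}a_{i_1}a_{i_2}\cdots a_{i_j}$ is the complete homogeneous symmetric polynomial of degree $j$ in $n$ variables, with $h_0=1$. Here $n\ge1$ and $m\ge 1$ are integers, and $(r,s)\subset\mathbb{R}$ is an open interval, possibly unbounded. *)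

(* Defs.v *)
From HB Require Import structures.
From mathcomp Require Import all_boot all_order all_algebra.
From mathcomp Require Import reals constructive_ereal.

Set Implicit Arguments.
Unset Strict Implicit.
Unset Printing Implicit Defensive.

Import Order.TTheory GRing.Theory Num.Theory.
Local Open Scope ring_scope.

(* The complete homogeneous symmetric polynomial of degree j in n variables,
   as a function of the row vector a: the index (i_1, ..., i_j) is a j-tuple
   over 'I_n, restricted to the weakly increasing ones. *)
Definition hsym (R : comNzRingType) (n j : nat) (a : 'rV[R]_n) : R :=
  \sum_(t : j.-tuple 'I_n | sorted leq [seq val i | i <- t])
     \prod_(i <- t) a 0 i.

(* Only the values c j k with 1 <= j, k <= m matter. *)
Definition Hquad (R : comNzRingType) (n m : nat) (c : nat -> nat -> R)
    (a : 'rV[R]_n) : R :=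
  \sum_(1 <= j < m.+1) \sum_(1 <= k < m.+1) c j k * hsym j a * hsym k a.

Definition Pquad (R : comNzRingType) (n m : nat) (c : nat -> nat -> R)
    (x y : R) : R :=
  \sum_(1 <= j < m.+1) \sum_(1 <= k < m.+1)
     c j k * hsym j (const_mx x : 'rV[R]_n) * hsym k (const_mx y : 'rV[R]_n).

(* Main.v *)
(** Let L be the linear functional on polynomials with
    L(X^j) = h_j(a_1, .., a_n) / h_j(1, .., 1): L(q) is the mean of
    q(t_1 a_1 + .. + t_n a_n) over uniform weights t in the simplex.  Peeling off one point b turns L into
    a one-dimensional integral,
      L_(b :: s) q = n * \int_0^1 u^(n-1) L_s (q(u X + (1 - u) b)) du,  n = size s,
    so by induction L is nonnegative on polynomials that are nonnegative on an
    interval containing the a_i, and strictly positive if moreover q <> 0 and the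
    a_i are not all equal.  As h_j(x, .., x) = h_j(1, .., 1) x^j, H(a) is obtained
    from P(x, y) by applying L in x and then in y; P(y, y) > 0 for y <> 0 ensures
    that the polynomials met on the way are nonzero. *)

Require Import Defs.
From HB Require Import structures.
From mathcomp Require Import all_boot all_order all_algebra.
From mathcomp Require Import reals constructive_ereal.
From mathcomp Require Import polyrcf zify ring lra.

Set Implicit Arguments.
Unset Strict Implicit.
Unset Printing Implicit Defensive.

Import Order.TTheory GRing.Theory Num.Theory.
Local Open Scope ring_scope.

(** * Complete homogeneous polynomials by recursion on the list of variables *)

Fixpoint hseq (R : comNzRingType) (s : seq R) (j : nat) : R :=
  if s is b :: s' then \sum_(i < j.+1) b ^+ i * hseq s' (j - i)
  else (j == 0%N)%:R.

Lemma hseq0 (R : comNzRingType) (s : seq R) : hseq s 0 = 1.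
Proof. by elim: s => //= b s IH; rewrite big_ord1 expr0 mul1r subn0. Qed.

(** A monomial of degree [j.+1] either contains [b] or does not. *)
Lemma hseq_consS (R : comNzRingType) (b : R) s j :
  hseq (b :: s) j.+1 = b * hseq (b :: s) j + hseq s j.+1.
Proof.
rewrite /= big_ord_recl expr0 mul1r subn0 addrC mulr_sumr; congr (_ + _).
by apply: eq_bigr => i _; rewrite exprS mulrA.
Qed.

Lemma hseq_nseq (R : comNzRingType) (x : R) n j :
  hseq (nseq n.+1 x) j = 'C(n + j, j)%:R * x ^+ j.
Proof.
elim: n j => [|n IH]; elim=> [|j IHj]; rewrite ?hseq0 ?bin0 ?mulr1 //.
  by rewrite hseq_consS IHj /= !add0n !binn addr0 !mul1r exprS.
rewrite -[nseq n.+2 x]/(x :: nseq n.+1 x) hseq_consS IHj IH.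
by rewrite addSnnS addSn binS natrD exprS; ring.
Qed.

(** * Agreement of the tuple definition with the recursion *)

Section HsymHseq.
Variables (R : comNzRingType) (n : nat) (a : 'rV[R]_n).

(* The weakly increasing tuples with all entries at least k. *)
Let hpath k j : R :=
  \sum_(t : j.-tuple 'I_n | path leq k [seq val i | i <- t])
     \prod_(i <- t) a 0 i.

Let hpathS k j :
  hpath k j.+1 = \sum_(i < n | (k <= i)%N) a 0 i * hpath i j.
Proof.
rewrite /hpath (reindex (fun p : 'I_n * j.-tuple 'I_n => cons_tuple p.1 p.2)) /=.
  under [RHS]eq_bigr do rewrite mulr_sumr.
  rewrite pair_big_dep /=; apply: eq_bigr => p _.
  by rewrite big_cons.
exists (fun t => (thead t, [tuple of behead t])) => [[i t] _|t _] /=.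
  by congr (_, _); apply: val_inj.
by rewrite [RHS]tuple_eta; apply: val_inj.
Qed.

Let hpath0 k : hpath k 0 = 1.
Proof.
rewrite /hpath (big_pred1 [tuple]) ?big_nil // => t.
by rewrite tuple0 /= eqxx.
Qed.

(** Both sides obey the recursion of [hseq_consS]: either the first index is [k], or all indices are
    at least [k.+1]. *)
Let hpath_hseq k j :
  hpath k j = hseq (drop k [seq a 0 i | i <- enum 'I_n]) j.
Proof.
have sz : size [seq a 0 i | i <- enum 'I_n] = n by rewrite size_map size_enum_ord.
have [m] := ubnP (n - k); elim: m k j => // m IH k j le_m.
have [lt_kn|le_nk] := ltnP k n; last first.
  rewrite drop_oversize ?sz //.
  case: j => [|j]; rewrite ?hpath0 // hpathS big_pred0 // => i.
  by rewrite leqNgt (leq_trans (ltn_ord i)).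
rewrite (drop_nth 0) ?sz //.
rewrite (nth_map (Ordinal lt_kn)) ?size_enum_ord //.
have -> : nth (Ordinal lt_kn) (enum 'I_n) k = Ordinal lt_kn.
  by apply: val_inj; rewrite /= nth_enum_ord.
elim: j => [|j IHj]; first by rewrite hpath0 hseq0.
rewrite hseq_consS -IHj -IH; last by lia.
rewrite !hpathS (bigD1 (Ordinal lt_kn)) //=; congr (_ + _).
apply: eq_bigl => i; rewrite -val_eqE /=; lia.
Qed.

Lemma hsym_hseq j : hsym j a = hseq [seq a 0 i | i <- enum 'I_n] j.
Proof.
rewrite -[map _ _]drop0 -hpath_hseq /hsym /hpath.
by apply: eq_bigl => t; case: [seq _ | _ <- _].
Qed.

End HsymHseq.

Lemma hsym_const (R : comNzRingType) n j (x : R) :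
  hsym j (const_mx x : 'rV_n.+1) = 'C(n + j, j)%:R * x ^+ j.
Proof.
rewrite hsym_hseq -hseq_nseq; congr (hseq _ _).
rewrite (@eq_map _ _ _ (fun=> x)) => [|i]; last by rewrite mxE.
by rewrite -[in RHS](size_enum_ord n.+1); elim: (enum _) => //= i s ->.
Qed.

(** * Linear functionals on polynomials prescribed on monomials *)

Section MomentFunctional.
Variables (R : nzRingType) (w : nat -> R).

Definition moment (p : {poly R}) : R := \sum_(i < size p) p`_i * w i.

Lemma moment_widen (p : {poly R}) N :
  (size p <= N)%N -> moment p = \sum_(i < N) p`_i * w i.
Proof.
move=> le_pN; rewrite /moment (big_ord_widen _ (fun i => p`_i * w i) le_pN).
rewrite big_mkcond; apply: eq_bigr => i _; case: ltnP => // le_pi.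
by rewrite nth_default // mul0r.
Qed.

Fact moment_is_linear : linear_for *%R moment.
Proof.
move=> c p q; pose N := maxn (size p) (size q).
have leN : (size (c *: p + q)%R <= N)%N.
  by rewrite (leq_trans (size_polyD _ _)) // geq_max !leq_max size_scale_leq leqnn !orbT.
rewrite !(@moment_widen _ N) ?leq_maxl ?leq_maxr //.
rewrite mulr_sumr -big_split; apply: eq_bigr => i _ /=.
by rewrite coefD coefZ mulrDl mulrA.
Qed.

HB.instance Definition _ :=
  GRing.isLinear.Build R {poly R} R *%R moment moment_is_linear.

Lemma momentXn i : moment 'X^i = w i.
Proof.
rewrite /moment size_polyXn big_ord_recr /= coefXn eqxx mul1r big1 ?add0r // => j _.
by rewrite coefXn ltn_eqF ?mul0r.
Qed.

End MomentFunctional.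

(** * Integration of polynomials over [0, 1] *)

Section Positivity.
Variable R : rcfType.
Implicit Types (p q : {poly R}) (s : seq R).

(** The points a + (b - a) / (i + 1), for [i < size p], would be distinct roots, more than a nonzero
    [p] can have. *)
Lemma poly_eq0_itv p (a b : R) :
  a < b -> (forall x, a <= x <= b -> p.[x] = 0) -> p = 0.
Proof.
move=> lt_ab p0; apply/eqP; apply: contraT => nz_p.
pose rs := [seq a + (b - a) / i.+1%:R | i <- iota 0 (size p)].
have urs : uniq rs.
  rewrite map_inj_uniq ?iota_uniq // => i j /addrI /mulfI.
  by rewrite subr_eq0 gt_eqF // => /(_ isT) /invr_inj /eqP; rewrite eqr_nat => /eqP [].
suff /(max_poly_roots nz_p)/(_ urs) : all (root p) rs by rewrite size_map size_iota ltnn.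
apply/allP => _ /mapP[i _ ->]; apply/rootP/p0.
have i0 : 0 < i.+1%:R :> R by rewrite ltr0Sn.
rewrite lerDl divr_ge0 ?subr_ge0 ?(ltW lt_ab) //=.
rewrite -lerBrDl ler_pdivrMr // ler_peMr ?subr_ge0 ?(ltW lt_ab) //.
by rewrite ler1n.
Qed.

(** The integral over [0, 1], encoded by its moments so that it is purely algebraic. *)
Definition integral01 : {poly R} -> R := moment (fun i => i.+1%:R^-1).

HB.instance Definition _ := GRing.Linear.on integral01.

Lemma integral01Xn i : integral01 'X^i = i.+1%:R^-1.
Proof. exact: momentXn. Qed.

Lemma integral01_deriv p : integral01 p^`() = p.[1] - p.[0].
Proof.
rewrite -[p]coefK poly_def raddf_sum !horner_sum linear_sum -sumrB.
apply: eq_bigr => -[[|i] _] _ /=; rewrite derivZ linearZ /= derivXn !hornerE.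
  by rewrite mulr0n linear0 mulr0 subrr.
rewrite linearMn /= integral01Xn expr1n expr0n /= mulr0 subr0 mulr1.
by rewrite -[_^-1 *+ _]mulr_natr mulVf ?mulr1 // pnatr_eq0.
Qed.

(** A primitive [F] of [p] is nondecreasing on [0, 1]. If F(0) = F(1), it is constant there, hence a
    constant polynomial, and p = F' = 0. *)
Lemma integral01_ge0_gt0 p : (forall x, 0 <= x <= 1 -> 0 <= p.[x]) ->
  0 <= integral01 p /\ (p != 0 -> 0 < integral01 p).
Proof.
move=> p_ge0.
(* The constant coefficient is a division by 0, which is 0 by convention. *)
pose F := \poly_(i < (size p).+1) (p`_i.-1 / i%:R).
have F' : F^`() = p.
  apply/polyP => i; rewrite coef_deriv coef_poly ltnS.
  case: ltnP => [_|/(nth_default 0) ->]; last by rewrite mul0rn.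
  by rewrite -[_ *+ _ in LHS]mulr_natr /= divfK // pnatr_eq0.
have F_mono x y : 0 <= x -> x <= y -> y <= 1 -> F.[x] <= F.[y].
  move=> x0 xy y1; apply: (@ler_hornerW _ 0 1 F) => //.
  - by move=> z; rewrite in_itv F' /= => /andP[z0 z1]; rewrite p_ge0 // !ltW.
  - by rewrite in_itv /= x0 (le_trans xy).
  - by rewrite in_itv /= (le_trans x0).
rewrite -F' integral01_deriv F' subr_ge0 F_mono //; split=> // nz_p.
rewrite subr_gt0 lt_neqAle F_mono // andbT.
apply: contra nz_p => /eqP F01; rewrite -F' -[F](subrK F.[0]%:P).
rewrite [F - _](@poly_eq0_itv _ 0 1) ?add0r ?derivC // => x /andP[x0 x1].
rewrite !hornerE; apply/eqP; rewrite subr_eq0 eq_le {1}F01.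
by rewrite !F_mono.
Qed.

(** The Beta integral B(k + 1, i + 1) with its denominator cleared. *)
Lemma integral01_beta i k :
  integral01 ('X^k * (1 - 'X) ^+ i) * (k + i).+1`!%:R = k`!%:R * i`!%:R.
Proof.
elim: i k => [|i IH] k.
  rewrite expr0 mulr1 integral01Xn addn0 factS natrM mulrA mulVf ?pnatr_eq0 //.
  by rewrite mul1r mulr1.
(* Integration by parts; X^(k+1) (1 - X)^(i+1) vanishes at 0 and 1, so there is no boundary term. *)
have I_eq : k.+1%:R * integral01 ('X^k * (1 - 'X) ^+ i.+1) =
    i.+1%:R * integral01 ('X^(k.+1) * (1 - 'X) ^+ i).
  apply/eqP; rewrite -subr_eq0 !mulr_natl; apply/eqP.
  have := integral01_deriv ('X^(k.+1) * (1 - 'X) ^+ i.+1).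
  rewrite !hornerE subrr !expr0n /= !(mulr0, mul0r) subr0 => <-.
  rewrite derivM derivXn deriv_exp derivB derivC derivX sub0r /=.
  by rewrite mulN1r mulNrn mulrN !(mulrnAl, mulrnAr) linearB !linearMn.
have natfS l : l.+1`!%:R = l.+1%:R * l`!%:R :> R by rewrite factS natrM.
have := IH k.+1; rewrite addSnnS (natfS k) => IHk.
apply: (@mulfI _ k.+1%:R); rewrite ?pnatr_eq0 //.
rewrite (natfS i).
transitivity (k.+1%:R * integral01 ('X^k * (1 - 'X) ^+ i.+1) * (k + i.+1).+1`!%:R).
  by ring.
rewrite I_eq -mulrA IHk; ring.
Qed.

(** * The functional L and its positivity *)

Lemma bin_addr_fact k l : 'C(k + l, l)%:R = (k + l)`!%:R / (k`!%:R * l`!%:R) :> R.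
Proof.
have := bin_fact (leq_addl k l); rewrite addnK => /(congr1 (fun x => x%:R : R)).
rewrite !natrM [l`!%:R * _]mulrC => <-; rewrite mulfK // mulf_neq0 //;
  by rewrite pnatr_eq0 -lt0n fact_gt0.
Qed.

(** For nonempty [s] the binomial is h_j(1, .., 1) in [size s] variables, whence the predecessor. *)
Definition hmean_moment s j : R := hseq s j / 'C((size s).-1 + j, j)%:R.

Definition hmean s : {poly R} -> R := moment (hmean_moment s).

HB.instance Definition _ s := GRing.Linear.on (hmean s).

Lemma hmeanXn s j : hmean s 'X^j = hmean_moment s j.
Proof. exact: momentXn. Qed.

Lemma hseq_hmean s n j : size s = n.+1 -> hseq s j = 'C(n + j, j)%:R * hmean s 'X^j.
Proof.
move=> sz; rewrite hmeanXn /hmean_moment sz mulrC divfK //.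
by rewrite pnatr_eq0 -lt0n bin_gt0 leq_addl.
Qed.

Lemma hmean_nseq n x p : hmean (nseq n.+1 x) p = p.[x].
Proof.
rewrite -[p]coefK poly_def linear_sum horner_sum; apply: eq_bigr => j _ /=.
rewrite linearZ !hornerE /=; congr (_ * _).
have := @hseq_hmean (nseq n.+1 x) n j (size_nseq _ _); rewrite hseq_nseq.
by move/mulfI => ->; rewrite // pnatr_eq0 -lt0n bin_gt0 leq_addl.
Qed.

(* The polynomial in u whose value is the mean of p(u x + (1 - u) b). *)
Definition hmean_line s b p : {poly R} :=
  \sum_(j < size p) p`_j *: \sum_(i < j.+1)
    ('C(j, i)%:R * b ^+ i * hmean_moment s (j - i)) *: ('X^(j - i) * (1 - 'X) ^+ i).

(** Follows by binomial expansion of (u X + (1 - u) b)^j; it makes the integrand of [hmean_cons]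
    accessible to induction on the list. *)
Lemma horner_hmean_line s b p u :
  (hmean_line s b p).[u] = hmean s (p \Po (u *: 'X + ((1 - u) * b)%:P)).
Proof.
rewrite -[in RHS](coefK p) poly_def raddf_sum linear_sum horner_sum.
apply: eq_bigr => j _ /=; rewrite hornerZ comp_polyZ linearZ comp_Xn_poly /=.
congr (_ * _); rewrite exprDn linear_sum horner_sum.
apply: eq_bigr => i _ /=; rewrite linearMn /= !hornerE exprZn -rmorphXn /=.
rewrite [X in hmean s X]mulrC mul_polyC !linearZ /= hmeanXn exprMn -mulr_natl.
rewrite /hmean_moment; ring.
Qed.

(** On X^j, the Beta integral turns the normalization of each h_(j-i) of [s] into that of h_j of
    [b :: s], leaving the recursion of [hseq]. *)
Lemma hmean_cons s n b p : size s = n.+1 ->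
  hmean (b :: s) p = n.+1%:R * integral01 ('X^n * hmean_line s b p).
Proof.
move=> sz; rewrite -[in LHS](coefK p) poly_def linear_sum /hmean_line.
rewrite [X in integral01 X]mulr_sumr linear_sum mulr_sumr; apply: eq_bigr => j _.
rewrite linearZ -scalerAr linearZ /= mulrCA; congr (_ * _).
rewrite hmeanXn /hmean_moment /= mulr_suml [X in integral01 X]mulr_sumr.
rewrite linear_sum mulr_sumr; apply: eq_bigr => -[i /= le_ij] _.
rewrite -scalerAr linearZ /= [X in integral01 X]mulrA -exprD.
have := integral01_beta i (n + (j - i)).
have -> : (n + (j - i) + i)%N = (n + j)%N by rewrite -addnA subnK.
move/(canRL (mulfK _)) => ->; last by rewrite pnatr_eq0 -lt0n fact_gt0.
rewrite sz /=.
have := bin_addr_fact (j - i) i; rewrite subnK // => ->.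
rewrite (bin_addr_fact n.+1 j) (bin_addr_fact n (j - i)) addSn !factS !natrM.
have nf l : l`!%:R != 0 :> R by rewrite pnatr_eq0 -lt0n fact_gt0.
have n1 l : l.+1%:R != 0 :> R by rewrite pnatr_eq0.
by field; rewrite !nf -natrD !nat1r !n1.
Qed.

(** Induction through [hmean_cons]: convexity keeps u x + (1 - u) b in [D], so the integrand is
    nonnegative. For strictness it suffices that [hmean_line] is a nonzero polynomial. *)
Lemma hmean_ge0_gt0 (D : R -> Prop) b s p :
    (forall x y u : R, D x -> D y -> 0 <= u <= 1 -> D (u * x + (1 - u) * y)) ->
    {in b :: s, forall x, D x} -> (forall x, D x -> 0 <= p.[x]) ->
  0 <= hmean (b :: s) p /\
  (p != 0 -> ~~ constant (b :: s) -> 0 < hmean (b :: s) p).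
Proof.
move=> convD; elim: s b p => [|a s IH] b p Ds p_ge0.
  by rewrite (hmean_nseq 0) p_ge0 //; apply: Ds; rewrite inE eqxx.
have Db : D b by apply: Ds; rewrite inE eqxx.
have Das : {in a :: s, forall x, D x}.
  by move=> x x_as; apply: Ds; rewrite inE x_as orbT.
pose line (u : R) := u *: 'X + ((1 - u) * b)%:P : {poly R}.
have lineE (u x : R) : (p \Po line u).[x] = p.[u * x + (1 - u) * b].
  by rewrite horner_comp !hornerE.
have line_ge0 (u x : R) : 0 <= u <= 1 -> D x -> 0 <= (p \Po line u).[x].
  by move=> u01 Dx; rewrite lineE; apply/p_ge0/convD.
have A_ge0 (u : R) : 0 <= u <= 1 -> 0 <= (hmean_line (a :: s) b p).[u].
  move=> u01; rewrite horner_hmean_line.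
  by apply: (@IH a _ Das _).1 => x; apply: line_ge0.
rewrite (@hmean_cons (a :: s) (size s)) //.
have [u u01|I_ge0 I_gt0] := @integral01_ge0_gt0 ('X^(size s) * hmean_line (a :: s) b p).
  by rewrite !hornerE mulr_ge0 ?A_ge0 ?exprn_ge0 //; case/andP: u01.
split=> [|nz_p ncst]; first by rewrite mulr_ge0.
rewrite mulr_gt0 ?ltr0Sn // I_gt0 // mulf_neq0 ?expf_neq0 ?polyX_eq0 //.
have [cst|ncst_as] := boolP (constant (a :: s)); last first.
  (* At u = 1/2 the substituted line has degree 1, so the composition stays nonzero and the
     induction hypothesis gives a positive value. *)
  have half : 0 <= (2^-1 : R) <= 1 by lra.
  suff : 0 < (hmean_line (a :: s) b p).[2^-1].
    by apply: contraTneq => ->; rewrite horner0 ltxx.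
  rewrite horner_hmean_line.
  apply: (@IH a _ Das (fun x => @line_ge0 _ x half)).2 => //.
  have sz_line : size (line 2^-1) = 2%N.
    by rewrite /line -mul_polyC size_MXaddC polyC_eq0 size_polyC invr_eq0 pnatr_eq0.
  by rewrite -size_poly_eq0 size_comp_poly2 // size_poly_eq0.
apply: contra nz_p => /eqP A0.
have ne_ab : a != b.
  apply: contra ncst => /eqP <- /=; rewrite eqxx /=.
  exact: cst.
apply/eqP/(@poly_eq0_itv _ 0 1) => // x _.
(* All remaining points equal [a], so the mean is p(u a + (1 - u) b); this [u] makes the argument
   equal to [x]. *)
have := horner_hmean_line (a :: s) b p ((x - b) / (a - b)).
rewrite A0 horner0 -/(line _).
have -> : a :: s = nseq (size s).+1 a.
  by congr (_ :: _); apply/all_pred1P.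
rewrite hmean_nseq lineE => /esym; congr (p.[_] = _); field.
by rewrite subr_eq0.
Qed.

End Positivity.

(** * Applying L to P in each variable *)

Theorem theorem4 (R : realType) (n m : nat) (hn : (1 <= n)%N) (hm : (1 <= m)%N)
    (c : nat -> nat -> R) (r s : \bar R) (hrs : (r < s)%E)
    (hP : forall x y : R, (r < x%:E < s)%E -> (r < y%:E < s)%E ->
       (x, y) != (0, 0) -> 0 <= Pquad n m c x y)
    (hH : forall x : R, (r < x%:E < s)%E -> x != 0 ->
       0 < Hquad m c (const_mx x : 'rV[R]_n)) :
  forall a : 'rV[R]_n, (forall i : 'I_n, (r < (a 0 i)%:E < s)%E) -> a != 0 ->
    0 < Hquad m c a.
Proof.
case: n hn hP hH => // n _ hP hH a Da nz_a.
pose D x := (r < x%:E < s)%E.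
have convD (x y u : R) : D x -> D y -> 0 <= u <= 1 -> D (u * x + (1 - u) * y).
  move=> Dx Dy u01.
  wlog le_xy : x y u Dx Dy u01 / x <= y => [hw|].
    have [/hw|/ltW le_yx] := leP x y; first exact.
    have -> : u * x + (1 - u) * y = (1 - u) * y + (1 - (1 - u)) * x by ring.
    by apply: hw => //; lra.
  case/andP: Dx Dy => rx _ /andP[_ ys]; apply/andP; split.
    by apply: lt_le_trans rx _; rewrite lee_fin; nra.
  by apply: le_lt_trans _ ys; rewrite lee_fin; nra.
have [i0 nz_i0] : exists i, a 0 i != 0.
  apply/existsP; apply: contraNT nz_a => /existsPn a0.
  by apply/eqP/rowP => i; rewrite mxE; apply/eqP; rewrite -[_ == _]negbK a0.
pose vs := [seq a 0 i | i <- enum 'I_n.+1].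
have sz_vs : size vs = n.+1 by rewrite size_map size_enum_ord.
have [b [t vsE]] : exists b t, vs = b :: t.
  by case: (vs) sz_vs => // b t _; exists b, t.
have Dvs : {in b :: t, forall x, D x}.
  by rewrite -vsE => _ /mapP[i _ ->]; apply: Da.
(* Equal coordinates are settled by [hH]; otherwise the strict part of [hmean_ge0_gt0] is
   available. *)
have [cst|ncst] := boolP (constant (b :: t)).
  suff -> : a = const_mx (a 0 i0) by apply: hH.
  have allb : {in b :: t, forall x, x == b}.
    by apply/allP; rewrite /= eqxx.
  have ab i : a 0 i = b.
    by apply/eqP/allb; rewrite -vsE map_f ?mem_enum.
  by apply/rowP => i; rewrite mxE !ab.
pose w j : R := 'C(n + j, j)%:R.
have hE j : hsym j a = w j * hmean (b :: t) 'X^j.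
  by rewrite hsym_hseq -/vs vsE (@hseq_hmean _ _ n) // -vsE.
(* P(X, y) as a polynomial in its first variable. *)
pose p y : {poly R} :=
  \sum_(1 <= j < m.+1) (\sum_(1 <= k < m.+1) c j k * w j * w k * y ^+ k) *: 'X^j.
have pE x y : (p y).[x] = Pquad n.+1 m c x y.
  rewrite horner_sum; apply: eq_bigr => j _; rewrite hornerZ hornerXn mulr_suml.
  by apply: eq_bigr => k _; rewrite !hsym_const /w; ring.
(* L applied to P in the first variable, as a polynomial in the second. *)
pose q : {poly R} :=
  \sum_(1 <= k < m.+1) (\sum_(1 <= j < m.+1) c j k * w k * hsym j a) *: 'X^k.
have qE y : q.[y] = hmean (b :: t) (p y).
  rewrite horner_sum linear_sum /=.
  under eq_bigr do rewrite hornerZ hornerXn mulr_suml.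
  under [RHS]eq_bigr do rewrite linearZ /= mulr_suml.
  rewrite exchange_big; apply: eq_bigr => j _; apply: eq_bigr => k _.
  by rewrite hE; ring.
have -> : Hquad m c a = hmean (b :: t) q.
  rewrite /Hquad exchange_big linear_sum; apply: eq_bigr => k _ /=.
  rewrite linearZ /= mulr_suml; apply: eq_bigr => j _.
  by rewrite [hsym k a]hE; ring.
have p_ge0 y x : D y -> D x -> 0 <= (p y).[x].
  (* At the origin, excluded from [hP], P vanishes because the indices start at 1. *)
  move=> Dy Dx; rewrite pE; have [[-> ->]|] := eqVneq (x, y) (0, 0); last exact: hP.
  rewrite /Pquad big_nat big1 // => j /andP[j0 _]; rewrite big1 // => k _.
  by rewrite hsym_const expr0n gtn_eqF // !mulr0 mul0r.
have q_ge0 y : D y -> 0 <= q.[y].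
  by move=> Dy; rewrite qE (hmean_ge0_gt0 convD Dvs (fun x => @p_ge0 y x Dy)).1.
apply: (hmean_ge0_gt0 convD Dvs q_ge0).2 => //.
(* Let y be the nonzero coordinate [a 0 i0]. As P(y, y) = H(y, .., y) > 0, [p y] is nonzero, so its
   mean q(y) is positive. *)
apply/negP => /eqP q0.
have := (hmean_ge0_gt0 convD Dvs (fun x => @p_ge0 _ x (Da i0))).2.
rewrite -qE q0 horner0 ltxx => F; suff: false by [].
apply: F => //; apply/negP => /eqP p0.
have := hH _ (Da i0) nz_i0; rewrite -[Hquad _ _ _]/(Pquad n.+1 m c _ _).
by rewrite -pE p0 horner0 ltxx.
Qed.
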